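(* Let $k\ge 1$ and let $A$ be a primitive set contained in $\mathbb{N}_{\ge k}=\{n\in\mathbb{N}:\Omega(n)\ge k\}$. Then for any set $\mathcal{Q}$ of odd primes, $$f(A(\mathcal{Q}))\le f(\mathbb{N}_k(\mathcal{Q})),$$ where $A(\mathcal{Q})$ is the set of elements of $A$ all of whose prime factors lie in $\mathcal{Q}$, and $\mathbb{N}_k(\mathcal{Q})$ is the set of natural numbers $n$ with $\Omega(n)=k$ all of whose prime factors lie in $\mathcal{Q}$.
   Context: $\mathbb{N}=\{1,2,3,\dots\}$; $\Omega(n)$ is the number of prime factors of $n$ counted with multiplicity. A set $A\subset\mathbb{N}$ is primitive if no element of $A$ divides another distinct element of $A$. For a set $B$ of integers $\ge 2$, $f(B)\coloneq\sum_{b\in B}\frac{1}{b\log b}$ (possibly $+\infty$). *)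

(* Defs.v *)
From mathcomp Require Import all_boot all_order all_algebra.
From mathcomp Require Import all_classical all_reals all_analysis.
Set Implicit Arguments. Unset Strict Implicit. Unset Printing Implicit Defensive.
Import Order.TTheory GRing.Theory Num.Theory.
Local Open Scope ring_scope.
Local Open Scope classical_set_scope.

Definition Omega_count (n : nat) : nat := (\sum_(p <- primes n) logn p n)%N.

Definition primitive (A : set nat) : Prop :=
  forall a b, A a -> A b -> (a %| b)%N -> a = b.

Definition primes_in (Q : set nat) (n : nat) : Prop :=
  forall p, prime p -> (p %| n)%N -> Q p.

Definition restrictQ (A : set nat) (Q : set nat) : set nat :=
  [set n | A n /\ primes_in Q n].

Definition Nk (k : nat) (Q : set nat) : set nat :=
  [set n | (0 < n)%N /\ Omega_count n = k /\ primes_in Q n].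

(* f(B) = sum_{b in B} 1/(b log b), an extended nonnegative real (possibly +oo).
   Only used for sets B of integers >= 2. *)
Definition f (R : realType) (B : set nat) : \bar R :=
  (\sum_(n <oo | `[< B n >]) ((n%:R * ln (n%:R : R))^-1)%:E)%E.

(* Main.v *)
(* Write h(n) = 1/(n log n). Mass h(a) is placed on each a in A(Q) and moved
   down the divisor lattice one prime at a time until it reaches Omega = k: from
   n it goes to n/p with probability v_p(n) c_p log p / N(n), where
   c_p = p/(p-2) and N(n) = sum_p v_p(n) c_p log p. Since A is primitive, the
   theorem follows once the total mass through any odd m > 1 is at most h(m),
   i.e. once sum_p prob(pm -> m) h(pm) <= h(m). By AM-GM this reduces to
     sum_p (log p / (p-2)) / (L + log p)^2 <= 1/L      (L > 0, p odd),
   which is the Laplace transform of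
     sum_p (log p / (p-2)) p^(-s) <= 1/s               (s > 0).
   The latter comes from log m = sum_p v_p(m) log p summed against m^(-1-s)
   over odd m (an upper bound for -L'/L, L the Dirichlet series of the odd
   numbers), plus numerical bounds for the difference between 1/(p-2) and
   1/(p - p^(-s)). *)
Require Import Defs.
From mathcomp Require Import all_boot all_order all_algebra.
From mathcomp Require Import all_classical all_reals all_analysis.
From mathcomp Require Import ring lra zify.
Set Implicit Arguments. Unset Strict Implicit. Unset Printing Implicit Defensive.
Import Order.TTheory GRing.Theory Num.Theory.
Import numFieldNormedType.Exports.
Local Open Scope ring_scope.

(** * Monotonicity by derivatives and rational bounds for logarithms *)

Lemma derive_ge0_le (R : realType) (g dg : R -> R) (a b : R) :
  a <= b -> (forall x, a <= x <= b -> is_derive x 1 g (dg x)) ->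
  (forall x, a <= x <= b -> 0 <= dg x) -> g a <= g b.
Proof.
move=> ab dgx dg0.
have oo x : x \in `]a, b[ -> is_derive x 1 g (dg x).
  by rewrite in_itv/= => /andP[H1 H2]; apply: dgx; rewrite !ltW.
have d : {in `[a, b], forall x, derivable g x 1}.
  by move=> x; rewrite in_itv/= => /dgx; case.
have := MVT_segment ab oo; case.
  by apply/derivable_within_continuous; exact: d.
move=> x; rewrite in_itv/= => xab E.
by rewrite -subr_ge0 E mulr_ge0 ?subr_ge0// dg0.
Qed.

Lemma expR_ge2 (R : realType) (x : R) : 0 <= x -> 1 + x + x ^+ 2 / 2 <= expR x.
Proof.
move=> x0.
have H := @derive_ge0_le R (fun y => expR y - (1 + y + y ^+ 2 / 2))
  (fun y => expR y - (1 + y)) 0 x x0.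
rewrite -subr_ge0; apply: le_trans (H _ _).
- by rewrite expR0; lra.
- move=> y _; apply: is_derive_eq.
  rewrite /GRing.scale/=; by field.
- by move=> y _; rewrite subr_ge0 expR_ge1Dx.
Qed.

(** Since [1 + y + y^2/2 <= exp y], a bound on a logarithm becomes an inequality between rational
    numbers. The power [n] keeps [y] small, where the quadratic is sharp. *)
Lemma ln_le_pow (R : realType) (a y : R) (n : nat) :
  0 < a -> 0 <= y -> a <= (1 + y + y ^+ 2 / 2) ^+ n -> ln a <= y * n%:R.
Proof.
move=> a0 y0 h; rewrite -ler_expR lnK ?posrE// expRM_natr.
apply: le_trans h _; apply: lerXn2r; rewrite ?nnegrE ?expR_ge0//.
  by rewrite !addr_ge0 ?divr_ge0 ?exprn_ge0.
exact: expR_ge2.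
Qed.

(** This side rests on [1 - y <= exp (- y)]; being only of first order, it takes a larger [n] in the
    numerical instances. *)
Lemma ln_ge_pow (R : realType) (a y : R) (n : nat) :
  0 < a -> 0 <= 1 - y -> 1 <= a * (1 - y) ^+ n -> y * n%:R <= ln a.
Proof.
move=> a0 y0 h; rewrite -ler_expR lnK ?posrE// expRM_natr.
have e0 := expR_gt0 (- y).
have : 1 <= a * expR (- y) ^+ n.
  apply: le_trans h _; rewrite ler_pM2l//; apply: lerXn2r; rewrite ?nnegrE ?expR_ge0//.
  exact: expR_ge1Dx.
by rewrite expRN exprVn ler_pdivlMr ?exprn_gt0 ?expR_gt0// mul1r.
Qed.

Lemma ln3_le (R : realType) : ln (3 : R) <= 10987%:R / 10000%:R.
Proof.
have := @ln_le_pow R 3 (10987%:R / 640000%:R) 64 _ _ _.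
rewrite (_ : _ * 64 = 10987%:R / 10000%:R); last by field.
by apply; lra.
Qed.

Lemma ln3_ge (R : realType) : 1095%:R / 1000%:R <= ln (3 : R).
Proof.
have := @ln_ge_pow R 3 (1095%:R / 256000%:R) 256 _ _ _.
rewrite (_ : _ * 256 = 1095%:R / 1000%:R); last by field.
by apply; lra.
Qed.

Lemma ln5_ge (R : realType) : 16 / 10 <= ln (5 : R).
Proof.
have := @ln_ge_pow R 5 (16 / 2560%:R) 256 _ _ _.
rewrite (_ : _ * 256 = 16 / 10); last by field.
by apply; lra.
Qed.

Lemma ln5_le (R : realType) : ln (5 : R) <= 161 / 100.
Proof.
have := @ln_le_pow R 5 (161 / 6400%:R) 64 _ _ _.
rewrite (_ : _ * 64 = 161 / 100); last by field.
by apply; lra.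
Qed.

Lemma ln7_le (R : realType) : ln (7 : R) <= 1947%:R / 1000%:R.
Proof.
have := @ln_le_pow R 7 (1947%:R / 64000%:R) 64 _ _ _.
rewrite (_ : _ * 64 = 1947%:R / 1000%:R); last by field.
by apply; lra.
Qed.

Lemma ln7half_le (R : realType) : ln (15 / 2 : R) <= 2016%:R / 1000%:R.
Proof.
have := @ln_le_pow R (15 / 2) (2016%:R / 64000%:R) 64 _ _ _.
rewrite (_ : _ * 64 = 2016%:R / 1000%:R); last by field.
by apply; lra.
Qed.

Lemma ln12_ge (R : realType) : 24 / 10 <= ln (12 : R).
Proof.
have := @ln_ge_pow R 12 (24 / 2560%:R) 256 _ _ _.
rewrite (_ : _ * 256 = 24 / 10); last by field.
by apply; lra.
Qed.

(** * Numerical estimates *)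

(* The prime [3] together with the correction term of [odd_ln_sum_le]. *)
Lemma excess_at_3_le (R : realType) (s l u : R) : 0 < s ->
  1095%:R / 1000%:R <= l <= 10987%:R / 10000%:R ->
  u = expR (- (s * l)) ->
  (1 + s) * (l * (u * (2 - u)) / (3 - u)) + 2 * s * (l / 3 - l ^+ 2 / 4) * u
    <= 614 / 1000%:R.
Proof.
move=> s0 /andP[l1 l2] uE.
pose x := s * l; have x0 : 0 < x by rewrite mulr_gt0//; lra.
pose a := expR x.
have a2 : 1 + x + x ^+ 2 / 2 <= a by apply: expR_ge2; rewrite ltW.
have a0 : 0 < a := expR_gt0 x.
have a1 : 1 < a by nra.
have -> : u = a^-1 by rewrite uE /a expRN.
have -> : (1 + s) * (l * (a^-1 * (2 - a^-1)) / (3 - a^-1)) +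
    2 * s * (l / 3 - l ^+ 2 / 4) * a^-1 =
   ((l + x) * (2 * a - 1) + (2 / 3 - l / 2) * x * (3 * a - 1)) /
   (a * (3 * a - 1)).
  rewrite /x; field. by apply/andP; split; lra.
rewrite ler_pdivrMr; last by nra.
have h1 : (l + x) * (2 * a - 1) <= (10987%:R / 10000%:R + x) * (2 * a - 1) by nra.
have h2 : (2 / 3 - l / 2) * x * (3 * a - 1) <=
   (1192%:R / 10000%:R) * (x * (3 * a - 1)).
  by rewrite -mulrA; apply: ler_wpM2r; nra.
apply: le_trans (lerD h1 h2) _.
pose q := 1 + x + x ^+ 2 / 2; pose e := a - q.
have e0 : 0 <= e by rewrite subr_ge0.
have -> : a = q + e by rewrite /e; ring.
(* [q] is the Taylor lower bound of [a]; the remainder [e] enters with nonnegative coefficients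
   only, which leaves a quartic in [x]. *)
suff : 0 <= 614 / 1000%:R * (q * (3 * q - 1)) -
  (10987%:R / 10000%:R + x) * (2 * q - 1) - (1192%:R / 10000%:R) * (x * (3 * q - 1)).
  have : 0 <= e * x by nra.
  have : 0 <= e * x ^+ 2 by rewrite mulr_ge0// sqr_ge0.
  rewrite /q; nra.
rewrite /q.
(* The first square absorbs the quartic and cubic terms; the second completes the square in the
   quadratic that remains. *)
have := sqr_ge0 (x ^+ 2 + 72 / 100 * x - 46 / 100).
have := sqr_ge0 (x - 2875%:R / 10000%:R).
nra.
Qed.

(** Makes the correction at a prime [p >= 5] uniform in [s]: with [l = ln p], [1 + s] times the
    correction is at most [113/100 * excess p]. *)
Lemma excess_factor_le (R : realType) (s l u : R) : 0 < s -> 16 / 10 <= l ->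
  u = expR (- (s * l)) -> (1 + s) * (u * (2 - u)) <= 113 / 100.
Proof.
move=> s0 l1 uE.
pose x := s * l; have x0 : 0 < x by rewrite mulr_gt0//; lra.
pose a := expR x.
have a2 : 1 + x + x ^+ 2 / 2 <= a by apply: expR_ge2; rewrite ltW.
have a0 : 0 < a := expR_gt0 x.
have a1 : 1 < a by nra.
have -> : u = a^-1 by rewrite uE /a expRN.
have sx : s <= x * (625 / 1000%:R) by rewrite /x; nra.
have -> : (1 + s) * (a^-1 * (2 - a^-1)) = (1 + s) * (2 * a - 1) / a ^+ 2.
  by field; lra.
rewrite ler_pdivrMr; last by nra.
apply: (@le_trans _ _ ((1 + 625 / 1000%:R * x) * (2 * a - 1))); first by nra.
pose q := 1 + x + x ^+ 2 / 2; pose e := a - q.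
have e0 : 0 <= e by rewrite subr_ge0.
have -> : a = q + e by rewrite /e; ring.
suff : 0 <= 113 / 100 * q ^+ 2 -
  (1 + 625 / 1000%:R * x) * (2 * q - 1).
  have : 0 <= e * x by nra.
  have : 0 <= e * x ^+ 2 by rewrite mulr_ge0// sqr_ge0.
  rewrite /q; nra.
rewrite /q.
have := sqr_ge0 (x ^+ 2 + 894 / 1000%:R * x - 6 / 10).
have := sqr_ge0 (x - 25 / 100).
nra.
Qed.

(** In the Taylor series, [55/100] replaces [1/3] to absorb the higher terms; the derivative of the
    difference keeps its sign up to [13/33]. The range ends at [9/(2 * 12)], as [log_tail_pair]
    requires. *)
Lemma ln_1B_ge (R : realType) (z : R) : 0 <= z <= 375 / 1000%:R ->
  - (z + z ^+ 2 / 2 + 55 / 100 * z ^+ 3) <= ln (1 - z).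
Proof.
move=> /andP[z0 z1].
pose F y : R := ln (1 - y) + (y + y ^+ 2 / 2 + 55 / 100 * y ^+ 3).
suff : F 0 <= F z by rewrite /F subr0 ln1; lra.
pose dF y : R := - (1 - y)^-1 + (1 + y + 165 / 100 * y ^+ 2).
apply: (@derive_ge0_le R F dF) => // y /andP[y0 y1].
  have y2 : 0 < 1 - y by lra.
  have Hl := @is_derive1_ln R (1 - y) y2.
  have Hb : is_derive y 1 (fun t : R => 1 - t) (-1).
    by apply: is_derive_eq; ring.
  have Hc := @is_derive1_comp R (@ln R) (fun t => 1 - t) y _ _ Hl Hb.
  apply: is_derive_eq; rewrite /dF /GRing.scale/=; lra.
have y2 : 0 < 1 - y by lra.
have -> : dF y = ((65 / 100) * y ^+ 2 - 165 / 100 * y ^+ 3) / (1 - y).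
  by rewrite /dF; field; lra.
apply: divr_ge0; last lra.
rewrite exprS; have := sqr_ge0 y; nra.
Qed.

Definition log_tail (R : realType) (x : R) : R := (ln x + 11 / 10) / x.

(* Primes above [7] are [y - 1] or [y + 1] with [6 %| y]; [log_tail] is, up to
   the 1/10, the antiderivative of [- ln x / x ^ 2]. *)
Lemma log_tail_pair (R : realType) (y : R) : 12 <= y ->
  ln (y - 1) / ((y - 2) * (y - 3)) + ln (y + 1) / (y * (y - 1)) <=
  (log_tail (y - 9 / 2) - log_tail (y + 3 / 2)) / 3.
Proof.
move=> y12; have y0 : 0 < y by lra.
have yi : 0 < y^-1 by rewrite invr_gt0.
have yy : y * y^-1 = 1 by rewrite divff// gt_eqF.
set L := ln y.
have L0 : 24 / 10 <= L.
  by apply: le_trans (ln12_ge R) _; rewrite ler_ln// posrE.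
have ln1 z : -1 < z -> ln (1 + z) <= z by exact: le_ln1Dx.
have lnS z : 0 < 1 + z / y -> ln (y + z) = L + ln (1 + z / y).
  by move=> z1; rewrite -lnM ?posrE//; congr ln; field; lra.
have pos z : - 11 <= z -> 0 < 1 + z / y.
  move=> hz; have -> : 1 + z / y = (y + z) / y by field; lra.
  by apply: divr_gt0; lra.
have h1 : ln (y - 1) <= L - y^-1.
  rewrite lnS; last by apply: pos; lra.
  by rewrite lerD2l mulN1r; apply: ln1; nra.
have h2 : ln (y + 1) <= L + y^-1.
  rewrite lnS; last by apply: pos; lra.
  by rewrite lerD2l mul1r; apply: ln1; nra.
have h3 : ln (y + 3 / 2) <= L + 3 / 2 / y.
  rewrite lnS; last by apply: pos; lra.
  by rewrite lerD2l; apply: ln1; nra.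
pose z := 9 / 2 / y.
have z0 : 0 <= z <= 375 / 1000%:R.
  by rewrite /z; apply/andP; split; nra.
have h4 : L - (z + z ^+ 2 / 2 + 55 / 100 * z ^+ 3) <= ln (y - 9 / 2).
  rewrite lnS; last by apply: pos; lra.
  by rewrite lerD2l mulNr; exact: ln_1B_ge.
rewrite /log_tail.
have p1 : 0 < y - 9 / 2 by lra.
have p2 : 0 < y + 3 / 2 by lra.
have p3 : 0 < (y - 2) * (y - 3) by apply: mulr_gt0; lra.
have p4 : 0 < y * (y - 1) by apply: mulr_gt0; lra.
apply: (@le_trans _ _ ((L - y^-1) / ((y - 2) * (y - 3)) + (L + y^-1) / (y * (y - 1)))).
  by apply: lerD; rewrite ler_pM2r ?invr_gt0.
apply: (@le_trans _ _ (((L - (z + z ^+ 2 / 2 + 55 / 100 * z ^+ 3) + 11 / 10) / (y - 9 / 2) -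
   (L + 3 / 2 / y + 11 / 10) / (y + 3 / 2)) / 3)); last first.
  rewrite ler_pM2r ?invr_gt0//; apply: lerB.
    by rewrite ler_pM2r ?invr_gt0// lerD2r.
  by rewrite ler_pM2r ?invr_gt0// lerD2r.
rewrite -subr_ge0.
(* [An] and [Bn] have positive coefficients in [t = y - 12]. *)
pose t := y - 12.
have t0 : 0 <= t by rewrite subr_ge0.
set D := (y - 9 / 2) * (y + 3 / 2) * ((y - 2) * (y - 3)) * (y * (y - 1)).
have D0 : 0 < D := mulr_gt0 (mulr_gt0 (mulr_gt0 p1 p2) p3) p4.
pose An := 12825%:R / 10 + 2415%:R / 10 * t + 115 / 10 * t ^+ 2.
pose Bn := 6897069%:R / 8 + 75329757%:R / 160 * t + 9695511%:R / 64 * t ^+ 2 +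
  319329%:R / 10 * t ^+ 3 + 1317537%:R / 320 * t ^+ 4 + 49229%:R / 160 * t ^+ 5 +
  489 / 40 * t ^+ 6 + 1 / 5 * t ^+ 7.
(* The difference is affine in [L]: [An] carries its slope and [Bn] its value at [L = 24/10], a
   lower bound for [ln 12]. *)
rewrite [X in 0 <= X](_ : _ = (L - 24 / 10) * An / D + Bn / (D * y ^+ 3)); last first.
  rewrite /D /An /Bn /t /z; field.
  by rewrite !gt_eqF//; lra.
have tn n : 0 <= t ^+ n by exact: exprn_ge0.
have An0 : 0 <= An by have := tn 2; rewrite /An; lra.
have Bn0 : 0 <= Bn.
  have := tn 2; have := tn 3; have := tn 4; have := tn 5; have := tn 6; have := tn 7.
  by rewrite /Bn; lra.
apply: addr_ge0; apply: divr_ge0 => //.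
- by apply: mulr_ge0 => //; rewrite subr_ge0.
- exact: ltW.
- by rewrite mulr_ge0 ?exprn_ge0 ?ltW.
Qed.
(** [ln n] times [1/(n - 2) - 1/(n - 1)]: the correction at a prime [n] in the limit [s -> 0]. *)
Definition excess (R : realType) (n : nat) : R := ln n%:R / ((n%:R - 1) * (n%:R - 2)).

Lemma not_prime_mul (p d : nat) : (d %| p)%N -> (1 < d < p)%N -> prime p = false.
Proof.
move=> dp /andP[d1 d2]; apply/negbTE/negP => /primeP[_ /(_ _ dp)] /orP[] /eqP E.
  by rewrite E in d1.
by rewrite E ltnn in d2.
Qed.

Lemma excess_ge0 (R : realType) (n : nat) : (2 < n)%N -> 0 <= excess R n.
Proof.
move=> n2; have h : 2 < (n%:R : R) by rewrite ltr_nat.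
apply: divr_ge0; first by apply: ln_ge0; lra.
by apply: mulr_ge0; lra.
Qed.

(** Among six consecutive integers from [6j + 8] on, only [6j + 11] and [6j + 13] can be prime. They
    are [y - 1] and [y + 1] for [y = 6j + 12], and the bounds of [log_tail_pair] telescope. *)
Lemma excess_sum_block_le (R : realType) (j : nat) :
  \sum_(5 <= p < 6 * j + 8 | prime p) excess R p <=
    excess R 5 + excess R 7 + (log_tail (15 / 2) - log_tail ((6 * j)%:R + 15 / 2)) / 3.
Proof.
elim: j => [|j IH].
  rewrite muln0 /= add0r subrr mul0r !addr0.
  by rewrite 3?big_ltn_cond// big_geq//= addr0.
rewrite (_ : 6 * j.+1 + 8 = (6 * j + 8) + 6)%N; last by rewrite mulnS -addnA addnC.
rewrite (@big_cat_nat _ _ _ (6 * j + 8)%N)//=; last 2 first.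
- by rewrite addnC.
- exact: leq_addr.
have p2 i : (6 * j + 8 + i.*2)%N = (2 * (3 * j + 4 + i))%N.
  by lia.
have dv2 i : prime (6 * j + 8 + i.*2) = false.
  apply: (@not_prime_mul _ 2); first by rewrite p2 dvdn_mulr.
  by lia.
have dv0 : prime (6 * j + 8) = false by rewrite -(dv2 0) addn0.
have dv3 : prime (6 * j + 8 + 1) = false.
  apply: (@not_prime_mul _ 3); last by lia.
  by rewrite (_ : 6 * j + 8 + 1 = 3 * (2 * j + 3))%N ?dvdn_mulr//; lia.
have -> : \sum_(6 * j + 8 <= p < 6 * j + 8 + 6 | prime p) excess R p =
   (if prime (6 * j + 8 + 3) then excess R (6 * j + 8 + 3) else 0) +
   (if prime (6 * j + 8 + 5) then excess R (6 * j + 8 + 5) else 0).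
  rewrite -{1}[(6 * j + 8)%N]add0n big_addn addKn.
  rewrite 6?big_ltn_cond// big_geq// ?add0n ![(_ + (6 * j + 8))%N]addnC.
  rewrite dv3 dv0 (dv2 1 : prime (_ + 2) = _) (dv2 2 : prime (_ + 4) = _).
  by case: ifP => _; case: ifP => _; rewrite ?addr0 ?add0r.
pose y : R := (6 * j + 12)%:R.
have y12 : 12 <= y by rewrite ler_nat leq_addl.
have yj : y = (6 * j)%:R + 12 by rewrite /y natrD.
have e11 : excess R (6 * j + 8 + 3) = ln (y - 1) / ((y - 2) * (y - 3)).
  have E : (6 * j + 8 + 3)%:R = y - 1 by rewrite !natrD yj; lra.
  by rewrite /excess E; congr (_ / _); ring.
have e13 : excess R (6 * j + 8 + 5) = ln (y + 1) / (y * (y - 1)).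
  have E : (6 * j + 8 + 5)%:R = y + 1 by rewrite !natrD yj; lra.
  by rewrite /excess E; congr (_ / _); ring.
have b11 : 0 <= excess R (6 * j + 8 + 3) by apply: excess_ge0; lia.
have b13 : 0 <= excess R (6 * j + 8 + 5) by apply: excess_ge0; lia.
have H : (if prime (6 * j + 8 + 3) then excess R (6 * j + 8 + 3) else 0) +
   (if prime (6 * j + 8 + 5) then excess R (6 * j + 8 + 5) else 0) <=
   excess R (6 * j + 8 + 3) + excess R (6 * j + 8 + 5).
  by apply: lerD; case: ifP.
apply: le_trans (lerD IH H) _.
have := log_tail_pair y12; rewrite -e11 -e13.
have -> : (6 * j.+1)%:R + 15 / 2 = y + 3 / 2 by rewrite mulnS natrD yj; lra.
have -> : (6 * j)%:R + 15 / 2 = y - 9 / 2 by rewrite yj; lra.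
lra.
Qed.

Lemma excess_sum_le (R : realType) (N : nat) :
  \sum_(5 <= p < N | prime p) excess R p <= 34 / 100.
Proof.
apply: (@le_trans _ _ (\sum_(5 <= p < 6 * N + 8 | prime p) excess R p)).
  have [N5|N5] := leqP N 5.
    rewrite big_geq// big_nat_cond; apply: sumr_ge0 => i /andP[/andP[i5 _] _].
    by apply: excess_ge0; exact: leq_trans i5.
  rewrite [leRHS](@big_cat_nat _ _ _ N)//=; last 2 first.
  - exact: ltnW.
  - by rewrite (leq_trans (leq_pmull N (isT : 0 < 6)%N))// leq_addr.
  rewrite lerDl big_nat_cond; apply: sumr_ge0 => i /andP[/andP[i5 _] _].
  by apply: excess_ge0; rewrite (leq_trans _ i5)// (leq_trans _ N5).
apply: le_trans (excess_sum_block_le R N) _.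
have h : 0 <= log_tail ((6 * N)%:R + 15 / 2 : R).
  have := ler0n R (6 * N) => h; apply: divr_ge0; last lra.
  by apply: addr_ge0; last lra; apply: ln_ge0; lra.
have h5 : excess R 5 <= 161 / 1200%:R.
  rewrite /excess (_ : (_ - 1) * _ = 12); last by ring.
  have := ln5_le R; lra.
have h7 : excess R 7 <= 1947%:R / 30000%:R.
  rewrite /excess (_ : (_ - 1) * _ = 30); last by ring.
  have := ln7_le R; lra.
have ht : log_tail (15 / 2 : R) <= 3116%:R / 7500%:R.
  rewrite /log_tail ler_pdivrMr; last lra.
  have := ln7half_le R; lra.
lra.
Qed.

(** * Dirichlet series over odd integers *)

(* [n^(-s)], with the junk value [1] at [n = 0]. *)
Definition ipow (R : realType) (s : R) (n : nat) : R := expR (- (s * ln n%:R)).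

Lemma ipow_gt0 (R : realType) (s : R) n : 0 < ipow s n.
Proof. exact: expR_gt0. Qed.

Lemma ipow1 (R : realType) (s : R) : ipow s 1 = 1.
Proof. by rewrite /ipow ln1 mulr0 oppr0 expR0. Qed.

Lemma ipowM (R : realType) (s : R) m n : (0 < m)%N -> (0 < n)%N ->
  ipow s (m * n) = ipow s m * ipow s n.
Proof.
by move=> m0 n0; rewrite /ipow natrM lnM ?posrE ?ltr0n// mulrDr opprD expRD.
Qed.

Lemma ipow1D (R : realType) (s : R) n : (0 < n)%N -> ipow (1 + s) n = ipow s n / n%:R.
Proof.
move=> n0; rewrite /ipow mulrDl mul1r opprD expRD mulrC; congr (_ * _).
by rewrite expRN lnK// posrE ltr0n.
Qed.

Lemma ipow_lt1 (R : realType) (s : R) n : 0 < s -> (1 < n)%N -> ipow s n < 1.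
Proof.
by move=> s0 n1; rewrite expR_lt1 oppr_lt0 mulr_gt0// ln_gt0// ltr1n.
Qed.

Lemma ipow_small (R : realType) (s e : R) : 0 < s -> 0 < e ->
  exists N, forall n, (N <= n)%N -> ipow s n <= e.
Proof.
move=> s0 e0; exists (Num.bound (expR (- ln e / s))).+1 => n hn.
have h : expR (- ln e / s) < n%:R.
  apply: lt_le_trans (_ : (Num.bound (expR (- ln e / s)))%:R <= _).
    by apply: le_lt_trans (archi_boundP _); rewrite ?ler_norm ?expR_ge0.
  by rewrite ler_nat ltnW.
have n0 : 0 < (n%:R : R) := lt_trans (expR_gt0 _) h.
rewrite -[e in leRHS]lnK ?posrE// ler_expR lerNl.
have : - ln e / s <= ln n%:R by rewrite -ler_expR lnK ?posrE// ltW.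
by rewrite ler_pdivrMr// mulrC.
Qed.

(* The trapezoid rule for [x^(-1-s)] on [x, y], with [y = x exp t]. *)
Lemma trapezoid_exp (R : realType) (s t : R) : 0 < s -> 0 <= t ->
  1 - expR (- (s * t)) <=
  s / 2 * ((expR t - 1) * (1 + expR (- t) * expR (- (s * t)))).
Proof.
move=> s0 t0.
pose H x := s / 2 * (expR x - 1 + expR (- s * x) - expR (- (1 + s) * x)) - 1 + expR (- s * x).
pose dH x := s / 2 * (expR x - s * expR (- s * x) + (1 + s) * expR (- (1 + s) * x))
    - s * expR (- s * x).
suff : H 0 <= H t.
  rewrite /H !mulr0 expR0 -!mulNr => h.
  have -> : (expR t - 1) * (1 + expR (- t) * expR (- s * t)) =
     expR t - 1 + expR (- s * t) - expR (- (1 + s) * t).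
    have -> : - (1 + s) * t = - t + - s * t by ring.
    rewrite expRD mulrDr mulr1 mulrBl mulrA expRxMexpNx_1; ring.
  lra.
apply: (@derive_ge0_le R H dH) => // x /andP[x0 _].
  by apply: is_derive_eq; rewrite /dH /GRing.scale/=; ring.
have -> : dH x = s / 2 * expR (- s * x) *
   (expR ((1 + s) * x) + (1 + s) * expR (- x) - (2 + s)).
  have e1 : expR x = expR (- s * x) * expR ((1 + s) * x).
    by rewrite -expRD; congr expR; ring.
  have e2 : expR (- (1 + s) * x) = expR (- s * x) * expR (- x).
    by rewrite -expRD; congr expR; ring.
  by rewrite /dH e1 e2; field.
apply: mulr_ge0; first by rewrite mulr_ge0 ?expR_ge0//; lra.
have h1 := expR_ge1Dx ((1 + s) * x); have h2 := expR_ge1Dx (- x).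
nra.
Qed.

Lemma trapezoid (R : realType) (s : R) (m n : nat) : 0 < s -> (0 < m <= n)%N ->
  (ipow s m - ipow s n) / s <=
  (n%:R - m%:R) / 2 * (ipow (1 + s) m + ipow (1 + s) n).
Proof.
move=> s0 /andP[m0 mn]; have n0 := leq_trans m0 mn.
have m0' : 0 < (m%:R : R) by rewrite ltr0n.
have n0' : 0 < (n%:R : R) by rewrite ltr0n.
pose t : R := ln n%:R - ln m%:R.
have t0 : 0 <= t by rewrite subr_ge0 ler_ln ?posrE// ler_nat.
have et : expR t = n%:R / m%:R by rewrite expRB !lnK ?posrE.
have ent : expR (- t) = m%:R / n%:R by rewrite expRN et invf_div.
have est : ipow s n = ipow s m * expR (- (s * t)).
  by rewrite /ipow -expRD; congr expR; rewrite /t; ring.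
have := trapezoid_exp s0 t0; rewrite et ent => h.
rewrite !ipow1D// est ler_pdivrMr//.
have i0 := ipow_gt0 s m.
have := ler_wpM2l (ltW i0) h.
rewrite mulrBr mulr1 => /le_trans; apply.
rewrite le_eqVlt; apply/orP; left; apply/eqP; field.
by rewrite !gt_eqF.
Qed.

Lemma mulr_expRN_nincr (R : realType) (a b : R) : 1 <= a -> a <= b ->
  b * expR (- b) <= a * expR (- a).
Proof.
move=> a1 ab.
have -> : expR (- a) = expR (b - a) * expR (- b) by rewrite -expRD; congr expR; ring.
rewrite mulrA; apply: ler_wpM2r; first exact: expR_ge0.
have := expR_ge1Dx (b - a); nra.
Qed.

(** Half the integral of [x^(-1-s) ln x] over [[n, +oo)]; the half accounts for the gap 2 between
    odd numbers. *)
Definition int_tail (R : realType) (s : R) (n : nat) : R :=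
  ipow s n * (ln n%:R / s + s ^- 2) / 2.

(** The integrand [x^(-1-s) ln x] decreases beyond [e < 3], so its value at the right end is at most
    its mean over [[n, n + 2]]. *)
Lemma int_tail_step (R : realType) (s : R) (n : nat) : 0 < s -> (3 <= n)%N ->
  ipow (1 + s) n.+2 * ln n.+2%:R <= int_tail s n - int_tail s n.+2.
Proof.
move=> s0 n3; set x : R := n%:R; set y : R := n.+2%:R.
have x3 : 3 <= x by rewrite ler_nat.
have yx : y = x + 2 by rewrite /y -addn2 natrD.
pose K := ipow (1 + s) n.+2 * ln y.
pose F t := - (expR (- s * ln t) * (ln t / s + s ^- 2) / 2) - t * K / 2.
pose dF t := (expR (- s * ln t) / t * ln t - K) / 2.
suff : F x <= F y.
  by rewrite /F !mulNr /int_tail /ipow -/x -/y -/K; lra.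
apply: (@derive_ge0_le R F dF) => [|t /andP[t1 t2]|t /andP[t1 t2]].
- lra.
- have t0 : 0 < t by lra.
  have Hl := @is_derive1_ln R t t0.
  have Hb : is_derive t 1 (fun t : R => - s * ln t) (- s * t^-1).
    by apply: is_derive_eq; rewrite /GRing.scale/=; ring.
  have Hc := @is_derive1_comp R (@expR R) (fun t => - s * ln t) t _ _ _ Hb.
  apply: is_derive_eq; rewrite /dF /GRing.scale/=; field.
  by rewrite !gt_eqF.
have t0 : 0 < t by lra.
have y0 : 0 < y by lra.
apply: divr_ge0 => //; rewrite subr_ge0 /K.
have E z : 0 < z -> expR (- s * ln z) / z = expR (- s * ln z) * expR (- ln z).
  by move=> z0; rewrite (expRN (ln z)) lnK.
have lt : ln t <= ln y by rewrite ler_ln ?posrE.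
have l1 : 1 <= ln t.
  apply: (@le_trans _ _ (ln 3)); first by have := ln3_ge R; lra.
  by rewrite ler_ln ?posrE//; lra.
rewrite ipow1D// /ipow -/y -mulNr !E// -!mulrA.
apply: ler_pM; rewrite ?expR_ge0//.
- by rewrite mulr_ge0 ?expR_ge0//; lra.
- by rewrite ler_expR !mulNr lerN2 ler_pM2l.
by rewrite mulrC [leRHS]mulrC; apply: mulr_expRN_nincr.
Qed.

Lemma sum_odd_double (V : nmodType) (F : nat -> V) (k : nat) :
  \sum_(0 <= m < k.*2 | odd m) F m = \sum_(i < k) F i.*2.+1.
Proof.
elim: k => [|k IH]; first by rewrite big_geq// big_ord0.
rewrite doubleS big_mkcond/= 2?big_nat_recr//= -big_mkcond/= IH big_ord_recr/=.
by rewrite odd_double addr0.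
Qed.

Definition odd_zeta (R : realType) (s : R) (X : nat) : R :=
  \sum_(0 <= m < X | odd m) ipow (1 + s) m.

(** The trapezoid rule with step 2 dominates half the integral of [x^(-1-s)] over [[1, 2k + 1]]; the
    end term at 1 is counted only by half there, which leaves the extra [2^-1]. *)
Lemma odd_zeta_ge (R : realType) (s : R) (k : nat) : 0 < s ->
  2^-1 + (1 - ipow s k.*2.+1) / (2 * s) <= odd_zeta s k.+1.*2.
Proof.
move=> s0; rewrite /odd_zeta sum_odd_double.
(* Half of the last term is kept, since the next trapezoid uses it up. *)
suff : 2^-1 + ipow (1 + s) k.*2.+1 / 2 + (1 - ipow s k.*2.+1) / (2 * s) <=
    \sum_(i < k.+1) ipow (1 + s) i.*2.+1.
  by have := ipow_gt0 (1 + s) k.*2.+1; lra.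
elim: k => [|k IH]; first by rewrite big_ord1 /= !ipow1 subrr mul0r; lra.
rewrite big_ord_recr/=.
have := @trapezoid R s k.*2.+1 k.+1.*2.+1 s0.
rewrite /= doubleS ltnS -addn2 leq_addr => /(_ isT).
rewrite (_ : _%:R - _ = 2); last by rewrite -addSn natrD; ring.
move: IH; set a := ipow s _; set b := ipow s _; set c := ipow _ _; set d := ipow _ _.
set S := bigop _ _ _ => IH.
rewrite divff// mul1r => h.
have e u v : (u - v) / (2 * s) = (u - v) / s / 2 by field; rewrite gt_eqF.
move: IH; rewrite !e.
have : (1 - b) / s = (1 - a) / s + (a - b) / s by rewrite -mulrDl; congr (_ / _); ring.
lra.
Qed.

(* [trap3 * 3^(-s)] bounds the amount by which [3^(-1-s) ln 3] exceeds half the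
   integral of [x^(-1-s) ln x] over [1, 3]. *)
Definition trap3 (R : realType) : R := ln 3 / 3 - (ln 3) ^+ 2 / 4.

Lemma trap3_ge0 (R : realType) : 0 <= trap3 R.
Proof. by have := ln3_ge R; have := ln3_le R; rewrite /trap3; nra. Qed.

Lemma int_tail_ge0 (R : realType) (s : R) n : 0 < s -> 0 <= int_tail s n.
Proof.
move=> s0; rewrite /int_tail; apply: divr_ge0 => //; apply: mulr_ge0.
  by rewrite ltW// ipow_gt0.
apply: addr_ge0; last by rewrite invr_ge0 sqr_ge0.
apply: divr_ge0; last exact: ltW.
by case: n => [|n]; [rewrite ln0|rewrite ln_ge0// ler1n].
Qed.

(** The term at 1 vanishes, the terms from 5 on are compared with the integral by [int_tail_step],
    and [trap3] pays for the term at 3, where the integrand is not yet monotone on [[1, 3]]. *)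
Lemma odd_ln_sum_le (R : realType) (s : R) (X : nat) : 0 < s ->
  \sum_(0 <= m < X | odd m) ipow (1 + s) m * ln m%:R <=
  s ^- 2 / 2 + trap3 R * ipow s 3.
Proof.
move=> s0.
have F0 m : 0 <= ipow (1 + s) m * ln m%:R.
  apply: mulr_ge0; first by rewrite ltW ?ipow_gt0.
  by case: m => [|m]; [rewrite ln0|rewrite ln_ge0// ler1n].
apply: (@le_trans _ _ (\sum_(0 <= m < X.+2.*2 | odd m) ipow (1 + s) m * ln m%:R)).
  rewrite [leRHS](@big_cat_nat _ _ _ X)//=; last by lia.
  by rewrite lerDl; apply: sumr_ge0.
rewrite sum_odd_double.
suff : \sum_(i < X.+2) ipow (1 + s) i.*2.+1 * ln i.*2.+1%:R <=
  s ^- 2 / 2 + trap3 R * ipow s 3 - int_tail s X.+1.*2.+1.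
  by have := int_tail_ge0 X.+1.*2.+1 s0; lra.
elim: X => [|X IH]; last first.
  rewrite big_ord_recr/=.
  have := @int_tail_step R s X.+1.*2.+1 s0 isT.
  by rewrite -doubleS; lra.
rewrite big_ord_recr big_ord1/= ipow1 ln1 mulr0 add0r /int_tail /trap3 ipow1D//.
set l := ln 3; set u := ipow s 3.
have u0 : 0 < u := ipow_gt0 s 3.
have l1 : 1095%:R / 1000%:R <= l := ln3_ge R.
(* The quadratic bound on [exp (s l)]; the slack in it is exactly the loss in the estimate at 3. *)
have h : u * (1 + s * l + (s * l) ^+ 2 / 2) <= 1.
  rewrite /u /ipow -/l expRN mulrC ler_pdivrMr ?expR_gt0// mul1r.
  by apply: expR_ge2; rewrite mulr_ge0//; lra.
have -> : u / 3 * l = s ^- 2 / 2 + (l / 3 - l ^+ 2 / 4) * u - u * (l / s + s ^- 2) / 2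
   - (1 - u * (1 + s * l + (s * l) ^+ 2 / 2)) * (s ^- 2 / 2).
  by field; rewrite gt_eqF.
rewrite gerBl; apply: mulr_ge0; first by rewrite subr_ge0.
by rewrite divr_ge0// invr_ge0 sqr_ge0.
Qed.

(** * Factorisation of [ln m] summed over odd [m] *)

Lemma sum_multiples (V : nmodType) (F : nat -> V) (p N : nat) : (0 < p)%N ->
  \sum_(0 <= n < N | (p %| n)%N) F n = \sum_(0 <= m < N | (p * m < N)%N) F (p * m)%N.
Proof.
move=> p0.
transitivity (\sum_(0 <= m < N) \sum_(0 <= n < N | n == (p * m)%N) F n); last first.
  rewrite [RHS]big_mkcond/=; apply: eq_bigr => m _.
  by rewrite big_nat1_eq/=.
rewrite (exchange_big_dep xpredT)//= big_mkcond/= !big_nat; apply: eq_bigr => n /andP[_ nN].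
case: ifP => [/dvdnP[q E]|pn].
  rewrite (eq_bigl (fun i => i == q)); last first.
    by move=> i; rewrite E [(q * p)%N]mulnC eqn_pmul2l// eq_sym.
  rewrite big_nat1_eq/= E; case: ifP => // /negP[].
  by apply: leq_ltn_trans nN; rewrite E leq_pmulr.
rewrite big_pred0// => i; apply/negbTE/negP => /eqP E.
by rewrite E dvdn_mulr in pn.
Qed.

Lemma sum_primes (V : nmodType) (F : nat -> V) (m B : nat) : (0 < m < B)%N ->
  \sum_(p <- primes m) F p = \sum_(0 <= p < B | prime p && (p %| m)%N) F p.
Proof.
move=> /andP[m0 mB].
rewrite (perm_big [seq p <- index_iota 0 B | (prime p) && (p %| m)%N]); last first.
  apply: uniq_perm; rewrite ?primes_uniq ?filter_uniq ?iota_uniq// => p.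
  rewrite mem_primes mem_filter mem_index_iota /= m0 /=.
  case: (prime p) => //=; case: (boolP (p %| m)%N) => //= /dvdn_leq -/(_ m0) pm.
  by rewrite (leq_ltn_trans pm).
by rewrite big_filter.
Qed.

Lemma sum_logn_ln (R : realType) (m B : nat) : (0 < m < B)%N ->
  \sum_(0 <= p < B | prime p) (logn p m)%:R * ln p%:R = ln m%:R :> R.
Proof.
move=> /andP[m0 mB].
rewrite [in RHS](prod_prime_decomp m0) prime_decompE big_map/=.
have -> : ln (\prod_(p <- primes m) p ^ logn p m)%:R =
    \sum_(p <- primes m) (logn p m)%:R * ln p%:R :> R.
  have : all (fun p => 0 < p)%N (primes m).
    by apply/allP => p; rewrite mem_primes => /andP[/prime_gt0].
  elim: (primes m) => [|p l IH] /=; first by rewrite !big_nil ln1.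
  move=> /andP[p0 l0]; rewrite !big_cons natrM lnM ?posrE ?ltr0n ?expn_gt0 ?p0//; last first.
    by rewrite big_seq prodn_cond_gt0// => i /(allP l0) i0; rewrite expn_gt0 i0.
  by rewrite IH// natrX lnXn ?ltr0n// mulr_natl.
rewrite (@sum_primes _ _ m B) ?m0// [RHS]big_mkcondr/=; apply: eq_bigr => p pp.
by case: ifP => // /negbT pm; rewrite lognE pp m0 (negbTE pm) mul0r.
Qed.

Lemma sum_logn_ln_le (R : realType) (m B : nat) : (0 < m)%N ->
  \sum_(3 <= p < B | prime p) (logn p m)%:R * ln p%:R <= ln m%:R :> R.
Proof.
move=> m0; rewrite -(@sum_logn_ln R m (3 + B + m.+1)); last by lia.
have F0 (i : nat) : 0 <= (logn i m)%:R * ln i%:R :> R.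
  apply: mulr_ge0 => //.
  by case: i => [|i]; [rewrite ln0|rewrite ln_ge0// ler1n].
rewrite [leRHS](@big_cat_nat _ _ _ 3)//=.
apply: ler_wpDl; first by apply: sumr_ge0.
have [B3|B3] := leqP B 3; first by rewrite big_geq// sumr_ge0.
rewrite [leRHS](@big_cat_nat _ _ _ B)//=; [|exact: ltnW|by lia].
by rewrite lerDl sumr_ge0.
Qed.

Definition odd_val_sum (R : realType) (s : R) (p X : nat) : R :=
  \sum_(0 <= m < X | odd m) (logn p m)%:R * ipow (1 + s) m.

Lemma le_odd_val_sum (R : realType) (s : R) (p X Y : nat) : (X <= Y)%N ->
  odd_val_sum s p X <= odd_val_sum s p Y.
Proof.
move=> XY; rewrite /odd_val_sum [leRHS](@big_cat_nat _ _ _ X)//= lerDl.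
by apply: sumr_ge0 => i _; rewrite mulr_ge0// ltW ?ipow_gt0.
Qed.

Lemma le_odd_zeta (R : realType) (s : R) (X Y : nat) : (X <= Y)%N ->
  odd_zeta s X <= odd_zeta s Y.
Proof.
move=> XY; rewrite /odd_zeta [leRHS](@big_cat_nat _ _ _ X)//= lerDl.
by apply: sumr_ge0 => i _; rewrite ltW ?ipow_gt0.
Qed.

(** Only multiples [p m] contribute, and [v_p(p m) = v_p(m) + 1]. *)
Lemma odd_val_sum_mul (R : realType) (s : R) (p X : nat) : prime p -> odd p ->
  odd_val_sum s p (p * X) = ipow (1 + s) p * (odd_val_sum s p X + odd_zeta s X).
Proof.
move=> pp op; have p0 := prime_gt0 pp.
pose f n : R := if odd n then (logn p n)%:R * ipow (1 + s) n else 0.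
transitivity (\sum_(0 <= n < p * X | (p %| n)%N) f n).
  rewrite /odd_val_sum big_mkcond [RHS]big_mkcond/=; apply: eq_bigr => n _.
  rewrite /f; case: ifP => on; case: ifP => // pn.
  by rewrite lognE pn !andbF mul0r.
rewrite sum_multiples// (eq_bigl (fun m => xpredT m && (m < X)%N)); last first.
  by move=> m; rewrite ltn_pmul2l.
rewrite -big_nat_widen ?leq_pmull// /odd_val_sum /odd_zeta -big_split/= mulr_sumr.
rewrite [RHS]big_mkcond/=; apply: eq_bigr => m _.
rewrite /f oddM op /=; case: ifP => // om.
have m0 : (0 < m)%N by case: m om.
by rewrite lognM// logn_prime// eqxx ipowM// natrD /=; ring.
Qed.

(** Iterating [odd_val_sum_mul] produces the geometric sum [r + ... + r^K] in front of
    [odd_zeta]. *)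
Lemma odd_val_sum_geom (R : realType) (s : R) (p X K : nat) : 0 < s -> prime p -> odd p ->
  let r := ipow (1 + s) p in
  (odd_zeta s X * (r * (1 - r ^+ K) / (1 - r)) <= odd_val_sum s p (p ^ K * X))%R.
Proof.
move=> s0 pp op /=.
have r1 : ipow (1 + s) p < 1 by apply: ipow_lt1; [lra|exact: prime_gt1].
have r0 := ipow_gt0 (1 + s) p.
elim: K => [|K IH].
  rewrite expr0 subrr mulr0 mul0r mulr0.
  by apply: sumr_ge0 => i _; rewrite mulr_ge0// ltW ?ipow_gt0.
rewrite expnS -mulnA odd_val_sum_mul//.
have pK : (X <= p ^ K * X)%N by rewrite leq_pmull// expn_gt0 prime_gt0.
have := le_odd_zeta s pK; move: IH.
set r := ipow _ p in r0 r1 *; set S := odd_zeta s X; set T := odd_val_sum _ _ _.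
set S' := odd_zeta _ _.
move=> IH SS.
apply: (@le_trans _ _ (r * (S * (r * (1 - r ^+ K) / (1 - r)) + S))); last first.
  by rewrite ler_pM2l// lerD.
rewrite le_eqVlt; apply/orP; left; apply/eqP; rewrite exprS; field; lra.
Qed.

(* [m <= B^K X] leaves room for the factors [p^a], [a <= K], in front of every
   odd number up to [X], uniformly in [p < B]. *)
Lemma vonMangoldt_sum_eps (R : realType) (s e : R) (B : nat) : 0 < s -> 0 < e < 1 ->
  (1 - e) ^+ 2 * ((1 + s^-1) / 2) *
    \sum_(3 <= p < B | prime p) ln p%:R * (ipow s p / (p%:R - ipow s p)) <=
  s ^- 2 / 2 + trap3 R * ipow s 3.
Proof.
move=> s0 /andP[e0 e1].
have s10 : 0 < 1 + s by lra.
(* [k] truncates the series over odd numbers and [K] the powers of a prime; each truncation costs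
   one factor [1 - e]. *)
have [k hk] := ipow_small s0 e0.
have [K hK] := ipow_small s10 e0.
have hS : (1 - e) * ((1 + s^-1) / 2) <= odd_zeta s k.+1.*2.
  apply: le_trans (odd_zeta_ge k s0).
  have := hk k.*2.+1 _; rewrite -addnn -addnS leq_addr => /(_ isT); set u := ipow _ _ => u1.
  have si : 0 < s^-1 by rewrite invr_gt0.
  by rewrite invfM; nra.
pose Y := (B ^ K * k.+1.*2)%N.
apply: le_trans (odd_ln_sum_le Y s0).
apply: (@le_trans _ _ (\sum_(0 <= m < Y | odd m)
   ipow (1 + s) m * \sum_(3 <= p < B | prime p) (logn p m)%:R * ln p%:R)); last first.
  apply: ler_sum => m om; apply: ler_wpM2l; first by rewrite ltW ?ipow_gt0.
  by apply: sum_logn_ln_le; case: m om.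
under [leRHS]eq_bigr do rewrite mulr_sumr.
rewrite exchange_big/= mulr_sumr [leLHS]big_nat_cond [leRHS]big_nat_cond.
apply: ler_sum => p /andP[/andP[p3 pB] pp].
have op : odd p by case/even_prime: pp p3 => [->|].
have -> : \sum_(0 <= i < Y | odd i) ipow (1 + s) i * ((logn p i)%:R * ln p%:R) =
    ln p%:R * odd_val_sum s p Y.
  by rewrite /odd_val_sum mulr_sumr; apply: eq_bigr => i _; ring.
have lp : 0 <= ln (p%:R : R) by rewrite ln_ge0// ler1n prime_gt0.
rewrite mulrCA; apply: ler_wpM2l => //.
have r1 : ipow (1 + s) p < 1 by apply: ipow_lt1 => //; exact: prime_gt1.
have r0 := ipow_gt0 (1 + s) p.
have rK : ipow (1 + s) p ^+ K <= e.
  have -> : ipow (1 + s) p ^+ K = ipow (1 + s) (p ^ K).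
    elim: K {hK Y} => [|K IH]; first by rewrite expr0 expn0 ipow1.
    by rewrite exprS expnS ipowM ?IH// ?expn_gt0 prime_gt0.
  by apply: hK; rewrite ltnW// ltn_expl// prime_gt1.
have := @odd_val_sum_geom R s p k.+1.*2 K s0 pp op.
have YY : (p ^ K * k.+1.*2 <= Y)%N.
  rewrite /Y leq_mul2r; apply/orP; right.
  by case: (K) => [|n]; [rewrite !expn0|rewrite leq_exp2r// ltnW].
move=> /= /le_trans /(_ (le_odd_val_sum s p YY)); apply: le_trans.
set r := ipow (1 + s) p in r0 r1 rK *; set S := odd_zeta _ _ in hS *.
have p0 : 0 < (p%:R : R) by rewrite ltr0n prime_gt0.
have -> : ipow s p / (p%:R - ipow s p) = r / (1 - r).
  have h : ipow s p = r * p%:R by rewrite /r ipow1D ?prime_gt0// divfK// gt_eqF.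
  by rewrite h; field; rewrite !gt_eqF//; nra.
have w0 : 0 <= r / (1 - r) by apply: divr_ge0; lra.
rewrite [leRHS](_ : _ = S * (1 - r ^+ K) * (r / (1 - r))); last by ring.
apply: ler_wpM2r => //; rewrite expr2 mulrAC.
have si : 0 < s^-1 by rewrite invr_gt0.
by apply: ler_pM => //; [nra|lra|lra].
Qed.

Lemma vonMangoldt_sum_le (R : realType) (s : R) (B : nat) : 0 < s ->
  \sum_(3 <= p < B | prime p) ln p%:R * (ipow s p / (p%:R - ipow s p)) <=
  (s^-1 + 2 * s * trap3 R * ipow s 3) / (1 + s).
Proof.
move=> s0; set V := bigop _ _ _.
pose U := s ^- 2 / 2 + trap3 R * ipow s 3; pose W := (1 + s^-1) / 2 * V.
have si : 0 < s^-1 by rewrite invr_gt0.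
have U0 : 0 < U.
  rewrite /U ltr_wpDr ?divr_gt0 ?invr_gt0 ?exprn_gt0//.
  by rewrite mulr_ge0 ?trap3_ge0// ltW ?ipow_gt0.
have WU : W <= U.
  rewrite leNgt; apply/negP => UW.
  have W0 : 0 < W by lra.
  (* With this [e], [(1 - e)^2 W >= W - 2 e W = (W + U)/2 > U]. *)
  pose e := (W - U) / (4 * W).
  have eW : e * W = (W - U) / 4 by rewrite /e; field; lra.
  have e0 : 0 < e by apply: divr_gt0; lra.
  have e1 : e < 1 by nra.
  have := @vonMangoldt_sum_eps R s e B s0.
  rewrite e0 e1 => /(_ isT); rewrite -mulrA -/V -/W -/U; nra.
rewrite ler_pdivlMr; last lra.
have -> : V * (1 + s) = W * (2 * s) by rewrite /W; field; lra.
have -> : s^-1 + 2 * s * trap3 R * ipow s 3 = U * (2 * s) by rewrite /U; field; lra.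
by rewrite ler_pM2r//; lra.
Qed.

(** After multiplication by [1 + s], the target exceeds [s^-1] by exactly 1. The prime 3 and the
    [trap3] term together use at most 614/1000 of this, the primes from 5 on at most
    [113/100 * 34/100]. *)
Lemma odd_prime_sum_le (R : realType) (s : R) (B : nat) : 0 < s ->
  \sum_(3 <= p < B | prime p) ln p%:R / (p%:R - 2) * ipow s p <= s^-1.
Proof.
move=> s0.
(* The difference of [p^(-s)/(p - 2)] and [p^(-s)/(p - p^(-s))]. *)
pose w (p : nat) : R := ipow s p * (2 - ipow s p) / ((p%:R - 2) * (p%:R - ipow s p)).
have u0 p : 0 < ipow s p := ipow_gt0 s p.
have u1 p : (2 < p)%N -> ipow s p < 1 by move=> p2; apply: ipow_lt1 => //; lia.
have p3 p : (2 < p)%N -> 3 <= (p%:R : R) by rewrite ler_nat.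
have w0 p : (2 < p)%N -> 0 <= ln p%:R * w p.
  move=> p2; have := u0 p; have := u1 p p2; have := p3 p p2 => h1 h2 h3.
  apply: mulr_ge0; first by apply: ln_ge0; lra.
  by apply: divr_ge0; apply: mulr_ge0; lra.
have -> : \sum_(3 <= p < B | prime p) ln p%:R / (p%:R - 2) * ipow s p =
   \sum_(3 <= p < B | prime p) ln p%:R * (ipow s p / (p%:R - ipow s p)) +
   \sum_(3 <= p < B | prime p) ln p%:R * w p.
  rewrite -big_split/= big_nat_cond [RHS]big_nat_cond.
  apply: eq_bigr => p /andP[/andP[p2 _] _].
  have := u0 p; have := u1 p p2; have := p3 p p2 => h1 h2 h3.
  by rewrite /w; field; lra.
have e3 : \sum_(3 <= p < B | prime p) ln p%:R * w p <=
    ln 3 * w 3 + \sum_(5 <= p < B | prime p) ln p%:R * w p.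
  have S0 m : (2 < m)%N -> 0 <= \sum_(m <= p < B | prime p) ln p%:R * w p.
    move=> m2; rewrite big_nat_cond; apply: sumr_ge0 => p /andP[/andP[mp _] _].
    by apply: w0; exact: leq_trans mp.
  have [B3|B3] := leqP B 3.
    by rewrite big_geq//; apply: addr_ge0; [apply: w0|apply: S0].
  rewrite big_ltn_cond//= lerD2l.
  have [B4|B4] := leqP B 4; first by rewrite big_geq// S0.
  by rewrite big_ltn_cond.
have e5 : (1 + s) * \sum_(5 <= p < B | prime p) ln p%:R * w p <= 113 / 100 * (34 / 100).
  apply: (@le_trans _ _ (113 / 100 * \sum_(5 <= p < B | prime p) excess R p)); last first.
    by rewrite ler_pM2l; [exact: excess_sum_le|lra].
  rewrite !mulr_sumr big_nat_cond [leRHS]big_nat_cond.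
  apply: ler_sum => p /andP[/andP[p5 _] _].
  have p2 : (2 < p)%N by exact: leq_trans p5.
  have pp5 : 5 <= (p%:R : R) by rewrite ler_nat.
  have := u0 p; have := u1 p p2 => h2 h3.
  have lp : 16 / 10 <= ln (p%:R : R).
    by apply: le_trans (ln5_ge R) _; rewrite ler_ln ?posrE//; lra.
  have := excess_factor_le s0 lp erefl; rewrite -/(ipow s p) => h.
  rewrite /w /excess mulrCA [leRHS]mulrCA; apply: ler_wpM2l; first lra.
  rewrite !mulrA in h *.
  apply: ler_pM => //.
  - by rewrite !mulr_ge0//; lra.
  - by rewrite invr_ge0 mulr_ge0//; lra.
  - by rewrite lef_pV2 ?posrE ?mulr_gt0//; [nra|lra..].
have e3' := @excess_at_3_le R s (ln 3) (ipow s 3) s0 _ erefl.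
rewrite ln3_ge ln3_le /= in e3'; have {}e3' := e3' isT.
have w3 : w 3 = ipow s 3 * (2 - ipow s 3) / (3 - ipow s 3).
  by rewrite /w (_ : 3 - 2 = 1) ?mul1r//; lra.
have := vonMangoldt_sum_le B s0; set V := bigop _ _ _ => hV.
move: e3 e5; set E := bigop _ _ _; set F := bigop _ _ _ => e3 e5.
rewrite w3 mulrA in e3; move: e3' e3; rewrite -/(trap3 R).
set X := ln 3 * _ / _ => e3' e3.
have si : 0 < s^-1 by rewrite invr_gt0.
rewrite -(@ler_pM2r _ (1 + s)); last lra.
rewrite ler_pdivlMr in hV; last lra.
have -> : s^-1 * (1 + s) = s^-1 + 1 by field; lra.
have : (1 + s) * E <= (1 + s) * X + (1 + s) * F by rewrite -mulrDr ler_pM2l//; lra.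
rewrite mulrDl; lra.
Qed.

(** * Laplace transform of the prime sum bound *)

Lemma is_derive_bigsum (R : realType) (I : Type) (r : seq I) (F dF : I -> R -> R) (x : R) :
  (forall i, is_derive x 1 (F i) (dF i x)) ->
  is_derive x 1 (fun y => \sum_(i <- r) F i y) (\sum_(i <- r) dF i x).
Proof.
move=> h; elim: r => [|i r IH].
  rewrite big_nil (_ : (fun _ => _) = cst 0); first exact: is_derive_cst.
  by apply/funext => y; rewrite big_nil.
rewrite big_cons (_ : (fun _ => _) = (F i) \+ (fun y => \sum_(i <- r) F i y)).
  exact: is_deriveD.
by apply/funext => y; rewrite big_cons.
Qed.

(* [1/L - sum a / (L + t)^2] is the integral over [s > 0] of
   [exp (- L s) (1 - s sum a exp (- s t))]; [- Phi] is the tail of that integral. *)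
Lemma laplace_le (R : realType) (I : eqType) (r : seq I) (a t : I -> R) (L : R) :
  0 < L -> {in r, forall i, 0 <= a i} -> (forall i, 0 <= t i) ->
  (forall s, 0 < s -> \sum_(i <- r) a i * expR (- (s * t i)) <= s^-1) ->
  \sum_(i <- r) a i / (L + t i) ^+ 2 <= L^-1.
Proof.
move=> L0 a0 t0 hs.
have Lt i : 0 < L + t i by have := t0 i; lra.
pose G i s := a i * (expR (- (L + t i) * s) * (s / (L + t i) + (L + t i) ^- 2)).
pose dG i s := - (s * (a i * expR (- (L + t i) * s))).
pose Phi s := \sum_(i <- r) G i s - expR (- L * s) / L.
pose dPhi s := \sum_(i <- r) dG i s + expR (- L * s).
pose C := (\sum_(i <- r) a i) * (2 / L ^+ 3).
have C0 : 0 <= C.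
  rewrite /C mulr_ge0 ?divr_ge0 ?exprn_ge0 ?(ltW L0)//.
  by rewrite big_seq; apply: sumr_ge0 => i; exact: a0.
have mono x : 0 < x -> Phi 0 <= Phi x.
  move=> x0; apply: (@derive_ge0_le R Phi dPhi); first exact: ltW.
    move=> y _.
    have H : is_derive y 1 (fun s => \sum_(i <- r) G i s) (\sum_(i <- r) dG i y).
      apply: is_derive_bigsum => i; apply: is_derive_eq.
      by rewrite /dG /GRing.scale/=; field; rewrite gt_eqF.
    apply: is_derive_eq; rewrite /dPhi /GRing.scale/=; field; lra.
  move=> y /andP[y0 _]; rewrite /dPhi.
  have [->|yn0] := eqVneq y 0.
    rewrite big1 ?add0r ?expR_ge0// => i _.
    by rewrite /dG mul0r oppr0.
  have yp : 0 < y by rewrite lt_neqAle eq_sym yn0.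
  have -> : \sum_(i <- r) dG i y =
      - (expR (- L * y) * (y * \sum_(i <- r) a i * expR (- (y * t i)))).
    rewrite !mulr_sumr -sumrN; apply: eq_bigr => i _; rewrite /dG.
    by rewrite (_ : - (L + t i) * y = - L * y + - (y * t i)) ?expRD; ring.
  have h : y * \sum_(i <- r) a i * expR (- (y * t i)) <= 1.
    by rewrite mulrC -ler_pdivlMr// mul1r; exact: hs.
  by have := expR_gt0 (- L * y); nra.
have bound x : 0 < x -> Phi x <= C / x.
  move=> x0; apply: (@le_trans _ _ (\sum_(i <- r) G i x)).
    by rewrite gerBl divr_ge0 ?expR_ge0// ltW.
  rewrite /C -mulrA mulr_suml big_seq [leRHS]big_seq; apply: ler_sum => i ir.
  apply: ler_wpM2l; first exact: a0.
  have Lx : 0 < L * x by rewrite mulr_gt0.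
  apply: (@le_trans _ _ (expR (- (L * x)) * (x / L + L ^- 2))).
    apply: ler_pM; rewrite ?expR_ge0//.
    - by rewrite addr_ge0 ?divr_ge0 ?invr_ge0 ?exprn_ge0 ?(ltW x0)// ltW.
    - by rewrite ler_expR mulNr lerN2 ler_pM2r//; have := t0 i; lra.
    - have h : (L + t i)^-1 <= L^-1 by rewrite lef_pV2 ?posrE//; have := t0 i; lra.
      apply: lerD; first by rewrite ler_pM2l.
      by rewrite -!exprVn; apply: lerXn2r; rewrite ?nnegrE ?invr_ge0// ltW.
  (* Quadratic growth of [exp (L x)] beats the linear factor and leaves a decay like [1/x]. *)
  have := expR_ge2 (ltW Lx); rewrite expRN; set E := expR _ => hE.
  have E0 : 0 < E := expR_gt0 _.
  rewrite mulrC ler_pdivrMr//.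
  have -> : x / L + L ^- 2 = (L * x + 1) / L ^+ 2 by field; lra.
  have -> : 2 / L ^+ 3 / x * E = (2 * E / (L * x)) / L ^+ 2 by field; lra.
  rewrite ler_pM2r ?invr_gt0 ?exprn_gt0// ler_pdivlMr//.
  nra.
have P0 : Phi 0 <= 0.
  rewrite leNgt; apply/negP => P0.
  pose x := (C + 1) / Phi 0.
  have x0 : 0 < x by apply: divr_gt0 => //; lra.
  have := le_trans (mono x x0) (bound x x0).
  rewrite ler_pdivlMr// /x mulrC divfK ?gt_eqF//; lra.
move: P0; rewrite /Phi mulr0 expR0 mul1r subr_le0.
rewrite (eq_bigr (fun i => a i / (L + t i) ^+ 2))// => i _.
by rewrite /G mulr0 expR0 mul0r add0r mul1r.
Qed.

Lemma odd_prime_sum_sqr_le (R : realType) (L : R) (B : nat) : 0 < L ->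
  \sum_(3 <= p < B | prime p) ln p%:R / (p%:R - 2) / (L + ln p%:R) ^+ 2 <= L^-1.
Proof.
move=> L0; rewrite -big_filter.
pose a (p : nat) : R := ln p%:R / (p%:R - 2).
apply: (@laplace_le R nat _ a (fun p => ln p%:R)) => // [p|p|s s0].
- rewrite mem_filter mem_index_iota => /and3P[_ p3 _].
  have h : 2 < (p%:R : R) by rewrite ltr_nat.
  by apply: divr_ge0; [apply: ln_ge0|]; lra.
- by case: p => [|p]; [rewrite ln0|rewrite ln_ge0// ler1n].
- by rewrite big_filter; exact: odd_prime_sum_le.
Qed.

(** * The downward chain *)

(* The solution of [c / p = (c - 1) / 2]: with it the inflow into [m] due to primes
   already dividing [m] is at most [(1/ln m - 1/weighted_log m) / 2]. *)
Definition prime_coef (R : realType) (p : nat) : R := p%:R / (p%:R - 2).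

(** The normalising constant [N(n)]; the cutoff [B] loses no prime factor of an odd [n < B]. *)
Definition weighted_log (R : realType) (B n : nat) : R :=
  \sum_(3 <= p < B | prime p) (logn p n)%:R * (prime_coef R p * ln p%:R).

Definition down_prob (R : realType) (B p n : nat) : R :=
  (logn p n)%:R * (prime_coef R p * ln p%:R) / weighted_log R B n.

Definition eweight (R : realType) (n : nat) : R := (n%:R * ln n%:R)^-1.

Lemma eweight_ge0 (R : realType) n : 0 <= eweight R n.
Proof.
rewrite invr_ge0 mulr_ge0//.
by case: n => [|n]; [rewrite ln0|rewrite ln_ge0// ler1n].
Qed.

Lemma prime_coef_ge1 (R : realType) (p : nat) : (2 < p)%N -> 1 <= prime_coef R p.
Proof.
move=> p2; have h : 2 < (p%:R : R) by rewrite ltr_nat.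
by rewrite /prime_coef ler_pdivlMr; lra.
Qed.

Lemma weighted_log_term_ge0 (R : realType) (p n : nat) : (2 < p)%N ->
  0 <= (logn p n)%:R * (prime_coef R p * ln p%:R).
Proof.
move=> p2; have := prime_coef_ge1 R p2 => h; rewrite mulr_ge0// mulr_ge0//; first lra.
by rewrite ln_ge0// ler1n (leq_trans _ p2).
Qed.

Lemma sum_logn_ln_odd (R : realType) (B m : nat) : odd m -> (m < B)%N ->
  \sum_(3 <= p < B | prime p) (logn p m)%:R * ln p%:R = ln m%:R :> R.
Proof.
move=> om mB; have m0 : (0 < m)%N by case: m om {mB}.
rewrite -(@sum_logn_ln R m B) ?m0//.
have z b : (b <= 3)%N -> \sum_(0 <= p < b | prime p) (logn p m)%:R * ln p%:R = 0 :> R.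
  move=> b3; rewrite big_nat_cond big1// => p /andP[/andP[_ pb] pp].
  have -> : p = 2 by move: (prime_gt1 pp) (leq_trans pb b3); lia.
  by rewrite lognE dvdn2 om andbF mul0r.
have [B3|B3] := leqP B 3; first by rewrite z// big_geq.
by rewrite [RHS](@big_cat_nat _ _ _ 3)//= ?z ?add0r// ltnW.
Qed.

Lemma ln_le_weighted_log (R : realType) (B m : nat) : odd m -> (m < B)%N ->
  ln m%:R <= weighted_log R B m.
Proof.
move=> om mB; rewrite -(@sum_logn_ln_odd R B m)// /weighted_log big_nat_cond [leRHS]big_nat_cond.
apply: ler_sum => p /andP[/andP[p2 _] _]; apply: ler_wpM2l => //.
apply: ler_peMl; last exact: prime_coef_ge1.
by rewrite ln_ge0// ler1n (leq_trans _ p2).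
Qed.

(** Rests on [prime_coef p - 1 = 2/(p - 2)]. *)
Lemma weighted_log_subr_ln (R : realType) (B m : nat) : odd m -> (m < B)%N ->
  \sum_(3 <= p < B | prime p) (logn p m)%:R * (ln p%:R / (p%:R - 2)) =
  (weighted_log R B m - ln m%:R) / 2.
Proof.
move=> om mB; rewrite -(@sum_logn_ln_odd R B m)// /weighted_log -sumrB mulr_suml.
rewrite big_nat_cond [RHS]big_nat_cond.
apply: eq_bigr => p /andP[/andP[p2 _] _].
have h : 2 < (p%:R : R) by rewrite ltr_nat.
by rewrite /prime_coef; field; lra.
Qed.

Lemma weighted_logM (R : realType) (B p m : nat) : prime p -> (2 < p < B)%N -> (0 < m)%N ->
  weighted_log R B (p * m) = weighted_log R B m + prime_coef R p * ln p%:R.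
Proof.
move=> pp /andP[p2 pB] m0; rewrite /weighted_log.
transitivity (\sum_(3 <= q < B | prime q) ((logn q m)%:R * (prime_coef R q * ln q%:R) +
    (if q == p then prime_coef R q * ln q%:R else 0))).
  apply: eq_bigr => q qp.
  rewrite lognM ?(prime_gt0 pp)// logn_prime// natrD mulrDl addrC; congr (_ + _).
  by case: eqP => _ /=; rewrite ?mul1r ?mul0r.
rewrite big_split/= -big_mkcondr/=; congr (_ + _).
rewrite (eq_bigl (fun q => q == p)); first by rewrite big_nat1_eq p2 pB.
by move=> q; rewrite andbC; case: eqP => // ->.
Qed.

(** Split [v_p(p m) = 1 + v_p(m)]. Up to the factor [1/m], the part from 1 gives at most
    [(1/L + 1/N)/2], by [odd_prime_sum_sqr_le] at [L] and at [N]; the part from [v_p(m)] gives at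
    most [(1/L - 1/N)/2]. The terms in [N] cancel. *)
Lemma down_prob_inflow_le (R : realType) (B m : nat) : odd m -> (1 < m < B)%N ->
  \sum_(3 <= p < B | prime p) down_prob R B p (p * m) * eweight R (p * m) <= eweight R m.
Proof.
move=> om /andP[m1 mB]; have m0 : (0 < m)%N by exact: ltnW.
set L : R := ln m%:R; set N := weighted_log R B m.
have L0 : 0 < L by rewrite ln_gt0// ltr1n.
have LN : L <= N by exact: ln_le_weighted_log.
have N0 : 0 < N by exact: lt_le_trans LN.
have mp : 0 < (m%:R : R) by rewrite ltr0n.
pose a p : R := ln p%:R / (p%:R - 2).
(* AM-GM: [1/((N + t)(L + t)) <= 1/2 (1/(L + t)^2 + 1/(N + t)^2)] *)
apply: (@le_trans _ _ (\sum_(3 <= p < B | prime p)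
  (m%:R^-1 * (2^-1 * (a p / (L + ln p%:R) ^+ 2) + 2^-1 * (a p / (N + ln p%:R) ^+ 2)
    + (N * L)^-1 * ((logn p m)%:R * a p))))); last first.
  rewrite -mulr_sumr !big_split/= -!mulr_sumr weighted_log_subr_ln// -/N -/L.
  have hL := odd_prime_sum_sqr_le B L0; have hN := odd_prime_sum_sqr_le B N0.
  rewrite /eweight -/L [in leRHS]invfM ler_pM2l ?invr_gt0//.
  have -> : (N * L)^-1 * ((N - L) / 2) = 2^-1 * L^-1 - 2^-1 * N^-1 by field; lra.
  rewrite /a; lra.
rewrite big_nat_cond [leRHS]big_nat_cond; apply: ler_sum => p /andP[/andP[p2 pB] pp].
have h : 2 < (p%:R : R) by rewrite ltr_nat.
set t : R := ln p%:R; have t0 : 0 < t by rewrite ln_gt0//; lra.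
have c1 := prime_coef_ge1 R p2; set c := prime_coef R p in c1.
have ap : c * t = p%:R * a p by rewrite /c /prime_coef /a -/t; field; lra.
have a0 : 0 < a p by apply: divr_gt0 => //; lra.
rewrite /down_prob /eweight weighted_logM ?p2// -/N -/c -/t.
rewrite lognM ?(prime_gt0 pp)// logn_prime// eqxx.
rewrite !natrM lnM ?posrE ?ltr0n ?(prime_gt0 pp)// -/t -/L natrD /=.
set v : R := (logn p m)%:R; have v0 : 0 <= v by [].
have Nt : 0 < N + t by lra.
have Lt : 0 < L + t by lra.
have ct : t <= c * t by rewrite ler_peMl// ltW.
have Nc : 0 < N + c * t by lra.
have -> : (1 + v) * (c * t) / (N + c * t) / (p%:R * m%:R * (t + L)) =
   m%:R^-1 * (((N + c * t)^-1 * (L + t)^-1) * a p + v * a p * ((N + c * t)^-1 * (L + t)^-1)).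
  by rewrite ap; field; rewrite -ap; lra.
rewrite ler_pM2l ?invr_gt0//; apply: lerD.
  apply: (@le_trans _ _ ((N + t)^-1 * (L + t)^-1 * a p)).
    rewrite ler_pM2r// ler_pM2r ?invr_gt0// lef_pV2 ?posrE//; lra.
  rewrite -!exprVn; set x := (N + t)^-1; set y := (L + t)^-1.
  by have := sqr_ge0 (x - y); nra.
rewrite mulrC invfM; apply: ler_wpM2r; first by rewrite mulr_ge0// ltW.
apply: ler_pM; rewrite ?invr_ge0 ?(ltW Nc) ?(ltW Lt)// lef_pV2 ?posrE//; lra.
Qed.

(** * Levels of [Omega] and transport of mass between them *)

Lemma Omega_count_range (m B : nat) : (0 < m < B)%N ->
  Omega_count m = (\sum_(0 <= p < B | prime p) logn p m)%N.
Proof.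
move=> mB; rewrite /Omega_count (sum_primes _ mB) [RHS]big_mkcond [LHS]big_mkcond/=.
apply: eq_bigr => p _; rewrite andbC; case: (boolP (p %| m)%N) => //= pm.
by rewrite lognE (negbTE pm) !andbF; case: ifP.
Qed.

Lemma Omega_countM (p m : nat) : prime p -> (0 < m)%N ->
  Omega_count (p * m) = (Omega_count m).+1.
Proof.
move=> pp m0; have p0 := prime_gt0 pp.
rewrite (@Omega_count_range (p * m) (p * m).+1) ?muln_gt0 ?p0 ?m0 ?ltnSn//.
rewrite (@Omega_count_range m (p * m).+1); last by rewrite m0 ltnS leq_pmull.
transitivity (\sum_(0 <= q < (p * m).+1 | prime q) (logn q m + (if q == p then 1 else 0)))%N.
  by apply: eq_bigr => q qp; rewrite lognM// logn_prime// addnC; case: eqP.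
rewrite big_split/= -[RHS]addn1; congr (_ + _)%N.
rewrite -big_mkcondr/= (eq_bigl (fun q => q == p)); last first.
  by move=> q; rewrite andbC; case: eqP => // ->.
by rewrite big_nat1_eq ltnS leq_pmulr.
Qed.

Lemma NkM (Q : set nat) (j p m : nat) : prime p -> Q p ->
  `[< Nk j.+1 Q (p * m) >] = `[< Nk j Q m >].
Proof.
move=> pp Qp; apply/asboolP/asboolP => -[].
  rewrite muln_gt0 => /andP[p0 m0] []; rewrite Omega_countM// => -[Om] PQ.
  by split=> //; split=> // q qp qm; apply: PQ => //; rewrite dvdn_mull.
move=> m0 [Om PQ]; split; first by rewrite muln_gt0 prime_gt0.
split; first by rewrite Omega_countM// Om.
move=> q qp; rewrite Euclid_dvdM// => /orP[|]; last exact: PQ.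
by rewrite dvdn_prime2// => /eqP ->.
Qed.

Lemma primes_in_odd (Q : set nat) (n : nat) : (forall p, Q p -> prime p /\ odd p) ->
  (0 < n)%N -> primes_in Q n -> odd n.
Proof.
move=> oQ n0 PQ; rewrite -[odd n]negbK -dvdn2; apply/negP => n2.
by have [] := oQ 2%N (PQ 2%N isT n2).
Qed.

Lemma Nk_odd_gt1 (Q : set nat) (j n : nat) : (forall p, Q p -> prime p /\ odd p) ->
  (0 < j)%N -> Nk j Q n -> odd n /\ (1 < n)%N.
Proof.
move=> oQ j0 [n0 [On PQ]]; split; first exact: primes_in_odd PQ.
case: n n0 On {PQ} => [|[|n]]//= _ E.
by rewrite -E /Omega_count big_nil in j0.
Qed.

(* Mass reaching [m] after at most [i] steps of the chain [n -> n / p] (taken with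
   probability [down_prob p n]) when each [a] in [A] starts with mass [eweight a]. *)
Fixpoint pushed_mass (R : realType) (A : pred nat) (Q : set nat) (B i m : nat) : R :=
  if i is i'.+1 then
    if A m then eweight R m else
    \sum_(3 <= p < B | [&& prime p, `[< Q p >] & (p * m < B)%N])
      down_prob R B p (p * m) * pushed_mass R A Q B i' (p * m)
  else 0.

Lemma down_prob_ge0 (R : realType) (B p n : nat) : (2 < p)%N -> 0 <= down_prob R B p n.
Proof.
move=> p2; apply: divr_ge0; first exact: weighted_log_term_ge0.
rewrite /weighted_log big_nat_cond; apply: sumr_ge0 => q /andP[/andP[q2 _] _].
exact: weighted_log_term_ge0.
Qed.

(** All of [weighted_log n] comes from primes of [Q] dividing [n], so a step of the chain loses no
    mass. *)
Lemma down_prob_sum1 (R : realType) (Q : set nat) (B n : nat) : odd n -> (1 < n < B)%N ->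
  primes_in Q n ->
  \sum_(3 <= p < B | [&& prime p, `[< Q p >] & (p %| n)%N]) down_prob R B p n = 1.
Proof.
move=> on /andP[n1 nB] PQ.
have N0 : 0 < weighted_log R B n.
  by apply: lt_le_trans (ln_le_weighted_log R on nB); rewrite ln_gt0// ltr1n.
rewrite -[RHS](divff (lt0r_neq0 N0)) {1}/weighted_log mulr_suml.
rewrite [RHS]big_mkcond [LHS]big_mkcond/=; apply: eq_bigr => p _.
case: (boolP (prime p)) => //= pp; case: (boolP (p %| n)%N) => [pn|pn].
  by rewrite asboolT//=; exact: PQ.
by rewrite andbF lognE (negbTE pn) !andbF !mul0r.
Qed.

(** An element of [A] carries its own weight; elsewhere each incoming mass is bounded by induction
    and the inflow bound applies. *)
Lemma pushed_mass_le (R : realType) (A : pred nat) (Q : set nat) (B i m : nat) :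
  odd m -> (1 < m < B)%N -> pushed_mass R A Q B i m <= eweight R m.
Proof.
elim: i m => [|i IH] m om mB /=; first exact: eweight_ge0.
case: ifP => // _; apply: le_trans (down_prob_inflow_le R om mB).
rewrite big_nat_cond [leRHS]big_nat_cond [leLHS]big_mkcond [leRHS]big_mkcond/=.
apply: ler_sum => p _; case: (boolP (3 <= p < B)%N) => //= /andP[p2 pB].
case: (boolP (prime p)) => //= pp.
case: ifP => [/andP[_ pmB]|_]; last by rewrite mulr_ge0 ?down_prob_ge0 ?eweight_ge0.
apply: ler_wpM2l; first exact: down_prob_ge0.
have op : odd p by case/even_prime: pp p2 => [->|].
apply: IH; first by rewrite oddM op.
rewrite pmB andbT; case/andP: mB => m1 _.
by apply: leq_trans m1 _; rewrite leq_pmull// prime_gt0.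
Qed.

(** Mass at [m] stems from multiples of [m] in [A]; these would be proper multiples of [a], against
    primitivity. *)
Lemma pushed_mass_eq0 (R : realType) (A : pred nat) (Q : set nat) (B i a m : nat) :
  (forall x y, A x -> A y -> (x %| y)%N -> x = y) ->
  A a -> (a %| m)%N -> (a < m)%N -> pushed_mass R A Q B i m = 0.
Proof.
move=> anti Aa; elim: i m => [|i IH] m am ltam //=.
case: ifP => [Am|_]; first by move: ltam; rewrite (anti _ _ Aa Am am) ltnn.
rewrite big1// => p /andP[pp _]; rewrite IH ?mulr0 ?dvdn_mull//.
by apply: leq_trans ltam _; rewrite leq_pmull// prime_gt0.
Qed.

(** Conservation of mass: a step lowers [Omega] by one, so level [j] holds what starts there and all
    that arrives from level [j + 1]. *)
Lemma pushed_mass_level (R : realType) (A : pred nat) (Q : set nat) (B i j : nat) :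
  (forall p, Q p -> prime p /\ odd p) -> (0 < j)%N ->
  (forall x y, A x -> A y -> (x %| y)%N -> x = y) ->
  \sum_(0 <= m < B | `[< Nk j Q m >]) pushed_mass R A Q B i.+1 m =
  \sum_(0 <= m < B | `[< Nk j Q m >] && A m) eweight R m +
  \sum_(0 <= n < B | `[< Nk j.+1 Q n >]) pushed_mass R A Q B i n.
Proof.
move=> oQ j0 anti.
pose W m := \sum_(3 <= p < B | [&& prime p, `[< Q p >] & (p * m < B)%N])
      down_prob R B p (p * m) * pushed_mass R A Q B i (p * m).
(* [pushed_mass] ignores the inflow at elements of [A]; by primitivity that inflow is zero. *)
have WA m : (0 < m)%N -> A m -> W m = 0.
  move=> m0 Am; rewrite /W big1// => p /andP[pp _].
  rewrite (pushed_mass_eq0 R Q B i anti Am) ?mulr0 ?dvdn_mull//.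
  by rewrite ltn_Pmull// prime_gt1.
transitivity (\sum_(0 <= m < B | `[< Nk j Q m >]) ((if A m then eweight R m else 0) + W m)).
  apply: eq_bigr => m /asboolP[m0 _] /=; case: ifP => [Am|_]; last by rewrite add0r.
  by rewrite WA// addr0.
rewrite big_split/= -big_mkcondr/=; congr (_ + _).
rewrite /W.
transitivity (\sum_(3 <= p < B | prime p && `[< Q p >])
   \sum_(0 <= m < B | (p * m < B)%N) (if `[< Nk j.+1 Q (p * m) >] then
      down_prob R B p (p * m) * pushed_mass R A Q B i (p * m) else 0)).
  rewrite (exchange_big_dep (fun p => prime p && `[< Q p >]))/=; last first.
    by move=> m p _ /and3P[-> ->].
  apply: eq_bigr => p /andP[pp /asboolP Qp].
  rewrite -big_mkcondr/=; apply: eq_bigl => m.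
  by rewrite pp (asboolT Qp)/= NkM// andbC.
(* Reindexing by [n = p m] regroups the flow by its source, where the probabilities sum to 1. *)
transitivity (\sum_(3 <= p < B | prime p && `[< Q p >])
   \sum_(0 <= n < B | `[< Nk j.+1 Q n >] && (p %| n)%N)
      down_prob R B p n * pushed_mass R A Q B i n).
  apply: eq_bigr => p /andP[pp _].
  rewrite -(@sum_multiples _ (fun n => if `[< Nk j.+1 Q n >] then
      down_prob R B p n * pushed_mass R A Q B i n else 0))/=; last exact: prime_gt0.
  by rewrite -big_mkcondr/=; apply: eq_bigl => n; rewrite andbC.
rewrite (exchange_big_dep (fun n => `[< Nk j.+1 Q n >]))/=; last by move=> p n _ /andP[].
rewrite big_nat_cond [RHS]big_nat_cond; apply: eq_bigr => n /andP[/andP[_ nB] /asboolP Nn].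
rewrite -mulr_suml (eq_bigl (fun p => [&& prime p, `[< Q p >] & (p %| n)%N])); last first.
  by move=> p; rewrite (asboolT Nn)/= andbA.
have [on n1] := Nk_odd_gt1 oQ (ltn0Sn _) Nn.
by rewrite down_prob_sum1 ?mul1r// ?n1//; case: Nn => _ [].
Qed.

Lemma truncated_sum_le (R : realType) (k B : nat) (A Q : set nat) :
  (1 <= k)%N -> primitive A ->
  (forall n, A n -> (0 < n)%N /\ (k <= Omega_count n)%N) ->
  (forall p, Q p -> prime p /\ odd p) ->
  \sum_(0 <= n < B | `[< restrictQ A Q n >]) eweight R n <=
  \sum_(0 <= n < B | `[< Nk k Q n >]) eweight R n.
Proof.
move=> k1 primA Ak oQ.
pose A' : pred nat := fun n => `[< restrictQ A Q n >].
have anti x y : A' x -> A' y -> (x %| y)%N -> x = y.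
  by move=> /asboolP[Ax _] /asboolP[Ay _]; exact: primA.
have level i j : (0 < j)%N ->
    \sum_(0 <= m < B | `[< Nk j Q m >]) pushed_mass R A' Q B i m =
    \sum_(d < i) \sum_(0 <= m < B | `[< Nk (j + d) Q m >] && A' m) eweight R m.
  elim: i j => [|i IH] j j0; first by rewrite big_ord0 big1.
  rewrite pushed_mass_level// IH// big_ord_recl addn0; congr (_ + _).
  by apply: eq_bigr => d _; rewrite addSnnS.
(* A crude number of steps, above [Omega] of every [m < B], so that all the mass reaches level
   [k]. *)
pose J := (\sum_(0 <= m < B) Omega_count m).+1.
apply: (@le_trans _ _ (\sum_(0 <= m < B | `[< Nk k Q m >]) pushed_mass R A' Q B J m)); last first.
  rewrite big_nat_cond [leRHS]big_nat_cond; apply: ler_sum => m /andP[/andP[_ mB] /asboolP Nm].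
  by have [om m1] := Nk_odd_gt1 oQ k1 Nm; apply: pushed_mass_le => //; rewrite m1.
rewrite level// (exchange_big_dep A')/=; last by move=> d m _ /andP[].
rewrite big_nat_cond [leRHS]big_nat_cond; apply: ler_sum => m /andP[/andP[_ mB] Am].
have [Ams PQ] := asboolP _ Am.
have [m0 km] := Ak _ Ams.
(* An element [m] of [A] is counted at the level [d = Omega m - k] above [k]. *)
have dI : (Omega_count m - k < J)%N.
  rewrite ltnS (leq_trans (leq_subr _ _))// (bigD1_seq m)/= ?iota_uniq ?mem_index_iota//.
  exact: leq_addr.
rewrite (bigD1 (Ordinal dI))/=; last first.
  rewrite (Am : A' m) andbT; by apply/asboolP; split=> //; split=> //; rewrite subnKC.
by rewrite lerDl sumr_ge0// => d _; exact: eweight_ge0.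
Qed.

Theorem theorem1p3 (R : realType) (k : nat) (A : set nat) (Q : set nat) :
  (1 <= k)%N ->
  primitive A ->
  (forall n, A n -> (0 < n)%N /\ (k <= Omega_count n)%N) ->
  (forall p, Q p -> prime p /\ odd p) ->
  (f R (restrictQ A Q) <= f R (Nk k Q))%E.
Proof.
move=> k1 primA Ak oQ; apply: lee_lim.
- by apply: is_cvg_ereal_nneg_natsum_cond => n _ _; rewrite lee_fin eweight_ge0.
- by apply: is_cvg_ereal_nneg_natsum_cond => n _ _; rewrite lee_fin eweight_ge0.
apply: nearW => B; rewrite !sumEFin lee_fin.
exact: truncated_sum_le.
Qed.
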